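(* Let $x>0$ and let $n\ge0$ be an integer. Then $$\mathrm{wi}_{0,n+1/2}(x)=\sum_{k=0}^{n}\frac{(n+k)!\,2^{-k}}{k!\,(n-k)!}\,\Gamma\left(-k,\frac x2\right).$$
   Context: The integral Whittaker function $\mathrm{wi}$ is $\mathrm{wi}_{\kappa,\mu}(x)=\int_x^\infty\frac{\mathrm{W}_{\kappa,\mu}(t)}{t}\,dt$, where for $t>0$ the Whittaker function is $\mathrm{W}_{\kappa,\mu}(t)=e^{-t/2}t^{\mu+1/2}\,\mathrm{U}\left(\frac12+\mu-\kappa,1+2\mu,t\right)$ with $\mathrm{U}$ the Tricomi confluent hypergeometric function. $\Gamma(\nu,z)=\int_z^\infty t^{\nu-1}e^{-t}\,dt$ is the upper incomplete gamma function. *)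

(* Defs.v *)
From Stdlib Require Export Reals Factorial ClassicalEpsilon.
From Coquelicot Require Export Coquelicot.
Open Scope R_scope.

(** [u] is the Tricomi solution with real parameters [a], [b] on the half-line
    [t > 0]: it solves Kummer's equation and is asymptotic to [t ^ (- a)] at
    infinity.  Every solution that is not a multiple of it grows like
    [exp t * t ^ (a - b)], so [u] is determined on [t > 0] for all real [a],
    [b], including integer [b].  [Derive] is a total function, hence the
    explicit differentiability requirements. *)
Definition is_tricomi (a b : R) (u : R -> R) : Prop :=
  (forall t : R, 0 < t ->
     ex_derive u t /\ ex_derive (Derive u) t /\
     t * Derive (Derive u) t + (b - t) * Derive u t - a * u t = 0) /\
  is_lim (fun t : R => Rpower t a * u t) p_infty 1.

(** Values at [t <= 0] are unspecified. *)
Definition tricomi_U (a b : R) : R -> R :=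
  epsilon (inhabits (fun _ : R => 0)) (is_tricomi a b).

Definition whittaker_W (kappa mu t : R) : R :=
  exp (- t / 2) * Rpower t (mu + 1 / 2) *
  tricomi_U (1 / 2 + mu - kappa) (1 + 2 * mu) t.

Definition whittaker_wi (kappa mu x : R) : R :=
  RInt_gen (fun t : R => whittaker_W kappa mu t / t)
    (at_point x) (Rbar_locally p_infty).

Definition upper_Gamma (nu z : R) : R :=
  RInt_gen (fun t : R => Rpower t (nu - 1) * exp (- t))
    (at_point z) (Rbar_locally p_infty).

(* Main.v *)
Require Import Defs.
From Stdlib Require Import Reals Factorial Lra Lia.
From Coquelicot Require Import Coquelicot.
Open Scope R_scope.

(** For [a = n + 1] and [b = 2 n + 2] Kummer's equation has a solution that is a
    finite sum of negative powers of [t] (a reverse Bessel polynomial), with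
    [t ^ a * U] tending to [1].  A Wronskian argument shows that any Tricomi
    solution equals it, so [W t / t] is a combination of the functions
    [exp (- t / 2) / t ^ (k + 1)], and the substitution [t = 2 s] turns each of
    their integrals into an upper incomplete gamma function. *)

(** * Uniqueness of the Tricomi solution *)

(** Since [ln t / t] tends to 0, [Rabs (p * ln t) <= t] for large [t], so the exponent
    [t + p * ln t] is nonnegative. Used with [p = 2 * a - b] to remove the growing factor from a
    bound on the Wronskian constant. *)
Lemma exp_Rpower_ge_1 (p : R) :
  Rbar_locally p_infty (fun t => 1 <= exp t * Rpower t p).
Proof.
destruct (proj2 (is_lim_spec _ _ _) is_lim_div_ln_p
  (mkposreal (/ (Rabs p + 1)) ltac:(apply Rinv_0_lt_compat; generalize (Rabs_pos p); lra)))
  as [M HM]; simpl in HM.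
exists (Rmax M 1); intros t Ht.
assert (hM := Rmax_l M 1); assert (h1 := Rmax_r M 1).
specialize (HM t ltac:(lra)); rewrite Rminus_0_r in HM.
unfold Rpower; rewrite <- exp_plus.
rewrite <- exp_0 at 1.
assert (hp := Rabs_pos p).
assert (Hln : Rabs (ln t) * (Rabs p + 1) <= t).
{ unfold Rdiv in HM; rewrite Rabs_mult, Rabs_inv, (Rabs_pos_eq t) in HM by lra.
  apply Rlt_le.
  apply Rmult_lt_reg_r with (/ (Rabs p + 1)); [apply Rinv_0_lt_compat; lra|].
  apply Rmult_lt_reg_r with (/ t); [apply Rinv_0_lt_compat; lra|].
  replace (t * / (Rabs p + 1) * / t) with (/ (Rabs p + 1)) by (field; lra).
  replace (Rabs (ln t) * (Rabs p + 1) * / (Rabs p + 1) * / t)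
    with (Rabs (ln t) * / t) by (field; lra).
  exact HM. }
assert (Hpl : Rabs (p * ln t) <= t).
{ rewrite Rabs_mult; generalize (Rabs_pos (ln t)); nra. }
apply Rabs_le_between in Hpl.
destruct (Req_dec (t + p * ln t) 0) as [->|Hne]; [lra|].
left; apply exp_increasing; lra.
Qed.

(** Abel's identity: [Rpower t b * exp (- t)] is the integrating factor of Kummer's equation, so its
    product with the Wronskian has zero derivative on the half-line, and [K] is the value of that
    product at 1. *)
Lemma is_tricomi_wronskian (a b : R) (u v : R -> R) :
  is_tricomi a b u -> is_tricomi a b v ->
  exists K, forall t, 0 < t ->
    Derive u t * v t - u t * Derive v t = K * exp t * Rpower t (- b).
Proof.
intros [Hu _] [Hv _].
set (k := fun t => (Derive u t * v t - u t * Derive v t) * (Rpower t b * exp (- t))).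
assert (Hk : forall t, 0 < t -> is_derive k t 0).
{ intros t ht; unfold k, Rpower.
  destruct (Hu t ht) as (Hu1 & Hu2 & Hu3); destruct (Hv t ht) as (Hv1 & Hv2 & Hv3).
  auto_derive; [repeat split; auto|].
  change (Derive (fun x => Derive u x) t) with (Derive (Derive u) t).
  change (Derive (fun x => Derive v x) t) with (Derive (Derive v) t).
  change (Derive (fun x => u x) t) with (Derive u t).
  change (Derive (fun x => v x) t) with (Derive v t).
  replace (Derive (Derive u) t) with ((a * u t - (b - t) * Derive u t) / t)
    by (apply Rmult_eq_reg_l with t; [field_simplify; lra | lra]).
  replace (Derive (Derive v) t) with ((a * v t - (b - t) * Derive v t) / t)
    by (apply Rmult_eq_reg_l with t; [field_simplify; lra | lra]).
  field; lra. }
exists (k 1); intros t ht.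
assert (Hc : k t = k 1).
{ destruct (Rtotal_order t 1) as [h | [-> | h]]; [| reflexivity |].
  - apply eq_is_derive; [|exact h]; intros s hs; apply Hk; lra.
  - symmetry; apply eq_is_derive; [|exact h]; intros s hs; apply Hk; lra. }
rewrite <- Hc; unfold k.
rewrite Rpower_Ropp, exp_Ropp.
field; split; apply Rgt_not_eq; apply exp_pos.
Qed.

(* With [q = u / v], the Wronskian formula gives [q' = K exp t t^(2a-b) / (t^a v)^2],
   which stays away from [0] at infinity unless [K = 0], while [q] tends to [1]. *)
Lemma is_tricomi_unique (a b : R) (u v : R -> R) :
  is_tricomi a b u -> is_tricomi a b v -> (forall t, 0 < t -> 0 < v t) ->
  forall t, 0 < t -> u t = v t.
Proof.
intros Hu Hv Hpos.
destruct (is_tricomi_wronskian a b u v Hu Hv) as [K HK].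
destruct Hu as [Hu Lu]; destruct Hv as [Hv Lv].
set (q := fun t => u t / v t).
set (q' := fun t => K * exp t * Rpower t (- b) / v t ^ 2).
assert (Hq : forall t, 0 < t -> is_derive q t (q' t)).
{ intros t ht; unfold q, q'; rewrite <- HK by exact ht.
  destruct (Hu t ht) as (Hu1 & _); destruct (Hv t ht) as (Hv1 & _).
  specialize (Hpos t ht).
  auto_derive; [repeat split; auto; lra|].
  change (Derive (fun x => u x) t) with (Derive u t).
  change (Derive (fun x => v x) t) with (Derive v t).
  field; lra. }
assert (Lq : is_lim q p_infty 1).
{ apply (is_lim_ext_loc (fun t => (Rpower t a * u t) / (Rpower t a * v t))).
  - exists 0; intros t ht; unfold q.
    specialize (Hpos t ht).
    field; split; [lra | apply Rgt_not_eq, exp_pos].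
  - replace (Finite 1) with (Rbar_div 1 1) by (simpl; f_equal; lra).
    apply is_lim_div; auto.
    + intro h; injection h; lra.
    + simpl; exact I. }
assert (K0 : K = 0).
{ apply Rminus_diag_uniq; rewrite Rminus_0_r.
  apply Rabs_eq_0; apply Rle_antisym; [|apply Rabs_pos].
  apply le_epsilon; intros eps heps; rewrite Rplus_0_l.
  (* The aim is [Rabs K <= eps]. Two values of [q] within [eps / 8] of 1 differ by less than
     [eps / 4], and [Rpower c a * v c], being within 1 of 1, has square at most 4. *)
  assert (he : 0 < eps / 8) by lra.
  destruct (proj2 (is_lim_spec _ _ _) Lq (mkposreal _ he)) as [M1 H1].
  destruct (proj2 (is_lim_spec _ _ _) Lv (mkposreal 1 Rlt_0_1)) as [M2 H2].
  destruct (exp_Rpower_ge_1 (2 * a - b)) as [M3 H3].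
  simpl in H1, H2.
  set (M := Rmax (Rmax M1 M2) (Rmax M3 0) + 1).
  assert (hM : M1 < M /\ M2 < M /\ M3 < M /\ 0 < M).
  { generalize (Rmax_l M1 M2) (Rmax_r M1 M2) (Rmax_l M3 0) (Rmax_r M3 0)
      (Rmax_l (Rmax M1 M2) (Rmax M3 0)) (Rmax_r (Rmax M1 M2) (Rmax M3 0)).
    unfold M; intros; lra. }
  (* The interval has length 1, so the increment of [q] is [q' c] itself. *)
  destruct (MVT_gen q M (M + 1) q') as (c & hc & Hc).
  - intros s hs; apply Hq; rewrite Rmin_left in hs by lra; lra.
  - intros s hs; apply derivable_continuous_pt.
    exists (q' s); apply is_derive_Reals, Hq.
    rewrite Rmin_left in hs by lra; lra.
  - rewrite Rmin_left, Rmax_right in hc by lra.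
    replace (M + 1 - M) with 1 in Hc by ring; rewrite Rmult_1_r in Hc.
    assert (B1 := H1 M ltac:(lra)); assert (B2 := H1 (M + 1) ltac:(lra)).
    assert (Bq : Rabs (q' c) < eps / 4).
    { rewrite <- Hc; apply Rabs_def2 in B1; apply Rabs_def2 in B2; apply Rabs_def1; lra. }
    specialize (H2 c ltac:(lra)); specialize (H3 c ltac:(lra)).
    apply Rabs_def2 in H2.
    specialize (Hpos c ltac:(lra)).
    (* The factor multiplying [K] is at least 1 by [H3], so [Rabs K] is at most [Rabs (q' c)] times
       the square. *)
    assert (Eq : q' c * (Rpower c a * v c) ^ 2 = K * (exp c * Rpower c (2 * a - b))).
    { unfold q'.
      replace (Rpower c (2 * a - b)) with (Rpower c a * Rpower c a * Rpower c (- b))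
        by (rewrite <- !Rpower_plus; f_equal; ring).
      field; lra. }
    apply (f_equal Rabs) in Eq; rewrite !Rabs_mult in Eq.
    rewrite (Rabs_pos_eq (_ ^ 2)) in Eq by apply pow2_ge_0.
    rewrite <- Rabs_mult, (Rabs_pos_eq (exp c * _)) in Eq by lra.
    set (y := Rpower c a * v c) in *.
    assert (y ^ 2 <= 4) by nra.
    generalize (Rabs_pos K) (Rabs_pos (q' c)); intros; nra. }
assert (Hcst : forall s t, 0 < s -> s < t -> q s = q t).
{ intros s t hs hst; apply eq_is_derive; [|exact hst].
  intros r hr; change zero with 0.
  replace 0 with (q' r) by (unfold q'; rewrite K0; unfold Rdiv; ring).
  apply Hq; lra. }
intros t ht.
assert (q1 : Finite (q t) = 1).
{ rewrite <- (is_lim_unique _ _ _ Lq); symmetry; apply is_lim_unique.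
  apply (is_lim_ext_loc (fun _ => q t)); [|apply is_lim_const].
  exists t; intros s hs; apply Hcst; lra. }
injection q1; unfold q; intro h; specialize (Hpos t ht).
apply Rmult_eq_reg_r with (/ v t); [|apply Rinv_neq_0_compat; lra].
fold (u t / v t); rewrite h; field; lra.
Qed.

(** * Termwise derivatives, limits and integrals *)

Lemma is_derive_sum_f_R0 (f : nat -> R -> R) (l : nat -> R) (n : nat) (t : R) :
  (forall k, is_derive (f k) t (l k)) ->
  is_derive (fun s => sum_f_R0 (fun k => f k s) n) t (sum_f_R0 l n).
Proof.
intro H; induction n as [|n IH]; simpl; [apply H|].
apply (is_derive_plus _ _ _ _ _ IH (H (S n))).
Qed.

Lemma is_lim_sum_f_R0 (f : nat -> R -> R) (l : nat -> R) (x : Rbar) (n : nat) :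
  (forall k, is_lim (f k) x (l k)) ->
  is_lim (fun s => sum_f_R0 (fun k => f k s) n) x (sum_f_R0 l n).
Proof.
intro H; induction n as [|n IH]; simpl; [apply H|].
apply (is_lim_plus' _ _ _ _ _ IH (H (S n))).
Qed.

Lemma is_RInt_gen_sum_f_R0 (Fa Fb : (R -> Prop) -> Prop) {FFa : Filter Fa} {FFb : Filter Fb}
  (f : nat -> R -> R) (l : nat -> R) (n : nat) :
  (forall k, is_RInt_gen (f k) Fa Fb (l k)) ->
  is_RInt_gen (fun s => sum_f_R0 (fun k => f k s) n) Fa Fb (sum_f_R0 l n).
Proof.
intro H; induction n as [|n IH]; simpl; [apply H|].
apply (is_RInt_gen_plus _ _ _ _ IH (H (S n))).
Qed.

Lemma is_derive_pow_inv (m : nat) (t : R) :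
  t <> 0 -> is_derive (fun s => (/ s) ^ m) t (- INR m * (/ t) ^ S m).
Proof.
intro ht; auto_derive; [exact ht|].
destruct m as [|m]; [simpl; ring|].
rewrite <- tech_pow_Rmult.
replace (pred (S m)) with m by reflexivity.
rewrite <- !tech_pow_Rmult; field; exact ht.
Qed.

(** * The Bessel polynomial solution of Kummer's equation *)

(** Coefficient of [x ^ k] in [y_n (2 x)], where [y_n] is the Bessel polynomial. Truncated
    subtraction keeps the formula positive even for [k > n]. *)
Definition bessel_coef (n k : nat) : R :=
  INR (fact (n + k)) / (INR (fact k) * INR (fact (n - k))).

Lemma bessel_coef_pos (n k : nat) : 0 < bessel_coef n k.
Proof.
unfold bessel_coef; apply Rdiv_lt_0_compat; [|apply Rmult_lt_0_compat]; apply INR_fact_lt_0.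
Qed.

(** The Frobenius recurrence for a series in [/ t]; it cancels adjacent terms in Kummer's
    equation. *)
Lemma bessel_coef_S (n k : nat) : (k < n)%nat ->
  INR (S k) * bessel_coef n (S k) = (INR n + 1 + INR k) * (INR n - INR k) * bessel_coef n k.
Proof.
intro h; unfold bessel_coef.
replace (n - k)%nat with (S (n - S k)) by lia.
rewrite Nat.add_succ_r.
rewrite !fact_simpl, !mult_INR.
replace (INR (S (n + k))) with (INR n + 1 + INR k) by (rewrite S_INR, plus_INR; ring).
replace (INR (S (n - S k))) with (INR n - INR k)
  by (rewrite <- minus_INR by lia; f_equal; lia).
assert (0 < INR n - INR k) by (apply lt_INR in h; lra).
field; repeat split; try apply INR_fact_neq_0; [lra|].
apply not_0_INR; lia.
Qed.

(** This is [y_n (2 / t) / t ^ (n + 1)]. *)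
Definition bessel_U (n : nat) (t : R) : R :=
  sum_f_R0 (fun k => bessel_coef n k * (/ t) ^ (n + 1 + k)) n.

Lemma bessel_U_pos (n : nat) (t : R) : 0 < t -> 0 < bessel_U n t.
Proof.
intro ht.
assert (H : forall k, 0 < bessel_coef n k * (/ t) ^ (n + 1 + k)).
{ intro k; apply Rmult_lt_0_compat; [apply bessel_coef_pos|].
  apply pow_lt, Rinv_0_lt_compat, ht. }
exact (tech1 _ _ (fun k _ => H k)).
Qed.

(** With [s = n + 1 + k], Kummer's operator sends [t ^ (- s)] to
    [k t ^ (- s) - s (n - k) t ^ (- s - 1)]. The recurrence cancels the second part against the
    first part of the next term. *)
Lemma is_tricomi_bessel_U (n : nat) :
  is_tricomi (INR n + 1) (2 * INR n + 2) (bessel_U n).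
Proof.
set (U1 := fun t => sum_f_R0 (fun k =>
  bessel_coef n k * (- INR (n + 1 + k) * (/ t) ^ S (n + 1 + k))) n).
set (U2 := fun t => sum_f_R0 (fun k => bessel_coef n k *
  (- INR (n + 1 + k) * (- INR (S (n + 1 + k)) * (/ t) ^ S (S (n + 1 + k))))) n).
assert (H1 : forall t, 0 < t -> is_derive (bessel_U n) t (U1 t)).
{ intros t ht; apply is_derive_sum_f_R0; intro k.
  apply (is_derive_scal (fun s => (/ s) ^ (n + 1 + k))), is_derive_pow_inv; lra. }
assert (E1 : forall t, 0 < t -> Derive (bessel_U n) t = U1 t)
  by (intros; apply is_derive_unique, H1; assumption).
assert (H2 : forall t, 0 < t -> is_derive (Derive (bessel_U n)) t (U2 t)).
{ intros t ht; apply (is_derive_ext_loc U1).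
  - exists (mkposreal t ht); intros s hs; symmetry; apply E1.
    change (Rabs (s - t) < t) in hs; apply Rabs_def2 in hs; lra.
  - apply is_derive_sum_f_R0; intro k.
    apply (is_derive_scal (fun s => - INR (n + 1 + k) * (/ s) ^ S (n + 1 + k))).
    apply (is_derive_scal (fun s => (/ s) ^ S (n + 1 + k))), is_derive_pow_inv; lra. }
split.
- intros t ht; split; [|split]; [eexists; apply H1, ht|eexists; apply H2, ht|].
  replace (Derive (Derive (bessel_U n)) t) with (U2 t)
    by (symmetry; apply is_derive_unique, H2, ht).
  rewrite E1 by exact ht.
  (* Kummer's operator applied to the first [m + 1] terms telescopes. *)
  assert (Htel : forall m, (m <= n)%nat ->
    t * sum_f_R0 (fun k => bessel_coef n k *
      (- INR (n + 1 + k) * (- INR (S (n + 1 + k)) * (/ t) ^ S (S (n + 1 + k))))) m +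
    (2 * INR n + 2 - t) * sum_f_R0 (fun k =>
      bessel_coef n k * (- INR (n + 1 + k) * (/ t) ^ S (n + 1 + k))) m -
    (INR n + 1) * sum_f_R0 (fun k => bessel_coef n k * (/ t) ^ (n + 1 + k)) m =
    - ((INR n + 1 + INR m) * (INR n - INR m) * bessel_coef n m) * (/ t) ^ S (n + 1 + m)).
  { induction m as [|m IH]; intro hm.
    - cbn [sum_f_R0]; rewrite Nat.add_0_r, <- !tech_pow_Rmult, !S_INR, !plus_INR; simpl (INR 1).
      simpl (INR 0); field; lra.
    - specialize (IH ltac:(lia)).
      rewrite !tech5.
      match goal with |- t * (?A + ?a) + ?B * (?C + ?c) - ?D * (?F + ?f) = _ =>
        replace (t * (A + a) + B * (C + c) - D * (F + f))
          with ((t * A + B * C - D * F) + (t * a + B * c - D * f)) by ring end.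
      rewrite IH, <- bessel_coef_S by lia.
      replace (n + 1 + S m)%nat with (S (n + 1 + m)) by lia.
      rewrite <- !tech_pow_Rmult, !S_INR, !plus_INR; simpl (INR 1).
      field; lra. }
  (* At [m = n] the leftover term carries the factor [INR n - INR n]. *)
  unfold U2, U1, bessel_U; rewrite Htel by lia; ring.
- apply (is_lim_ext_loc (fun t => sum_f_R0 (fun k => bessel_coef n k * (/ t) ^ k) n)).
  { exists 0; intros t ht; unfold bessel_U; rewrite scal_sum; apply sum_eq; intros k _.
    replace (INR n + 1) with (INR (n + 1)) by (rewrite plus_INR; reflexivity).
    rewrite Rpower_pow, (pow_add (/ t) (n + 1) k), !pow_inv by exact ht.
    field; split; apply pow_nonzero; lra. }
  (* The limit is the sum at [/ t = 0]; as [0 ^ 0] is 1, only the term [k = 0] survives, with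
     coefficient 1. *)
  replace 1 with (sum_f_R0 (fun k => bessel_coef n k * 0 ^ k) n).
  + apply is_lim_sum_f_R0; intro k.
    apply (is_lim_scal_l (fun t => (/ t) ^ k) (bessel_coef n k) p_infty (0 ^ k)).
    induction k as [|k IH]; simpl; [apply is_lim_const|].
    apply (is_lim_mult (fun t => / t) (fun t => (/ t) ^ k) p_infty 0 (0 ^ k));
      [|exact IH|exact I].
    change (Finite 0) with (Rbar_inv p_infty).
    apply is_lim_inv; [apply is_lim_id | discriminate].
  + assert (H : forall m, sum_f_R0 (fun k => bessel_coef n k * 0 ^ k) m = 1).
    { induction m as [|m IH]; [|rewrite tech5, IH; simpl; ring].
      unfold bessel_coef; simpl; rewrite Nat.add_0_r, Nat.sub_0_r.
      field; apply INR_fact_neq_0. }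
    apply H.
Qed.

(** The explicit solution provides the existence that [epsilon_spec] requires, and uniqueness then
    identifies the chosen function on the half-line. *)
Lemma tricomi_U_half_integer (n : nat) (t : R) :
  0 < t -> tricomi_U (INR n + 1) (2 * INR n + 2) t = bessel_U n t.
Proof.
intro ht; apply (is_tricomi_unique (INR n + 1) (2 * INR n + 2)); [| | |exact ht].
- unfold tricomi_U; apply epsilon_spec; exists (bessel_U n); apply is_tricomi_bessel_U.
- apply is_tricomi_bessel_U.
- apply bessel_U_pos.
Qed.

(** * Improper integrals and the incomplete gamma function *)

Lemma is_RInt_gen_comp_scal (f : R -> R) (c a l : R) : 0 < c ->
  is_RInt_gen f (at_point (c * a)) (Rbar_locally p_infty) l ->
  is_RInt_gen (fun t => c * f (c * t)) (at_point a) (Rbar_locally p_infty) l.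
Proof.
intros hc H P HP; destruct (H P HP) as [Q S HQ [M HM] HS].
apply (Filter_prod _ _ _ (fun s => s = a) (fun t => M / c < t)); [reflexivity|exists (M / c); auto|].
intros s t -> ht; simpl.
destruct (HS (c * a) (c * t) HQ) as (y & Hy & Py).
{ apply HM; apply Rmult_lt_reg_r with (/ c); [apply Rinv_0_lt_compat, hc|].
  replace (c * t * / c) with t by (field; lra); exact ht. }
exists y; split; [|exact Py]; simpl in Hy.
(* The added 0 matches the affine form [c * t + d] of the substitution rule. *)
apply (is_RInt_ext (fun t => scal c (f (c * t + 0)))).
- intros r _; rewrite Rplus_0_r; reflexivity.
- apply (is_RInt_comp_lin f c 0); rewrite !Rplus_0_r; exact Hy.
Qed.

(** [RInt_gen] is total, so convergence must be proved. For [nu <= 1] the power is nonincreasing,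
    hence at most [B], its value at [z]; integrals starting at [a] are then at most [B * exp (- a)],
    and Cauchy's criterion applies. *)
Lemma is_RInt_gen_upper_Gamma (nu z : R) : 0 < z -> nu <= 1 ->
  is_RInt_gen (fun t => Rpower t (nu - 1) * exp (- t))
    (at_point z) (Rbar_locally p_infty) (upper_Gamma nu z).
Proof.
intros hz hnu; set (g := fun t => Rpower t (nu - 1) * exp (- t)).
assert (Hex : forall a b, z <= a -> a <= b -> ex_RInt g a b).
{ intros a b ha hab; apply (ex_RInt_continuous (V := R_CompleteNormedModule)); intros t ht.
  rewrite Rmin_left, Rmax_right in ht by lra.
  apply (ex_derive_continuous g); unfold g, Rpower; auto_derive; lra. }
set (B := Rpower z (nu - 1)).
assert (Hbd : forall a b, z <= a -> a <= b -> Rabs (RInt g a b) <= B * exp (- a)).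
{ intros a b ha hab.
  assert (HI : is_RInt (fun t => B * exp (- t)) a b (B * exp (- a) - B * exp (- b))).
  { replace (B * exp (- a) - B * exp (- b))
      with (minus (- B * exp (- b)) (- B * exp (- a)))
      by (unfold minus, plus, opp; simpl; ring).
    apply (is_RInt_derive (V := R_CompleteNormedModule) (fun t => - B * exp (- t))).
    - intros t _; auto_derive; [exact I|ring].
    - intros t _; apply (ex_derive_continuous (fun t => B * exp (- t))); auto_derive; exact I. }
  apply Rle_trans with (B * exp (- a) - B * exp (- b)).
  - apply (norm_RInt_le g (fun t => B * exp (- t)) a b); [exact hab| |
      apply (RInt_correct (V := R_CompleteNormedModule)), Hex; assumption | exact HI].
    intros t ht; change (Rabs (g t) <= B * exp (- t)); unfold g.
    rewrite Rabs_pos_eq by (apply Rmult_le_pos; left; apply exp_pos).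
    apply Rmult_le_compat_r; [left; apply exp_pos|].
    (* Monotonicity in the base needs the nonnegative exponent [1 - nu]; inversion then reverses the
       inequality. *)
    unfold B; replace (nu - 1) with (- (1 - nu)) by ring; rewrite !Rpower_Ropp.
    apply Rinv_le_contravar; [apply exp_pos|].
    apply Rle_Rpower_l; lra.
  - generalize (exp_pos ((nu - 1) * ln z)) (exp_pos (- b)); fold (Rpower z (nu - 1)); fold B.
    intros; nra. }
destruct (proj1 (filterlim_locally_cauchy (U := R_CompleteSpace)
  (F := Rbar_locally p_infty) (fun T => RInt g z T))) as [l Hl].
{ intro eps.
  assert (Hlim : is_lim (fun t => B * exp (- t)) p_infty 0).
  { replace (Finite 0) with (Rbar_mult B 0) by (simpl; f_equal; ring).
    apply is_lim_scal_l.
    apply (is_lim_comp exp (fun t => - t) p_infty 0 m_infty); [apply is_lim_exp_m| |].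
    - apply (is_lim_opp (fun t => t) p_infty p_infty), is_lim_id.
    - exists 0; intros; discriminate. }
  destruct (proj2 (is_lim_spec _ _ _) Hlim eps) as [M HM].
  exists (fun t => Rmax M z < t); split; [exists (Rmax M z); auto|].
  assert (H : forall s t, Rmax M z < s -> s <= t -> Rabs (RInt g z t - RInt g z s) < eps).
  { intros s t hs hst; generalize (Rmax_l M z) (Rmax_r M z); intros.
    rewrite <- (RInt_Chasles g z s t) by (apply Hex; lra).
    change (Rabs (RInt g z s + RInt g s t - RInt g z s) < eps).
    rewrite Rplus_minus_l.
    apply Rle_lt_trans with (1 := Hbd s t ltac:(lra) hst).
    specialize (HM s ltac:(lra)); rewrite Rminus_0_r in HM.
    apply Rle_lt_trans with (1 := Rle_abs _); exact HM. }
  intros s t hs ht; change (Rabs (RInt g z t - RInt g z s) < eps).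
  destruct (Rle_dec s t); [apply H; assumption|].
  rewrite Rabs_minus_sym; apply H; [assumption|lra]. }
assert (Hgen : is_RInt_gen g (at_point z) (Rbar_locally p_infty) l).
{ intros P HP; destruct (Hl P HP) as [M HM].
  apply (Filter_prod _ _ _ (fun s => s = z) (fun t => Rmax M z < t));
    [reflexivity|exists (Rmax M z); auto|].
  intros s t -> ht; generalize (Rmax_l M z) (Rmax_r M z); intros.
  exists (RInt g z t); split; [apply (RInt_correct (V := R_CompleteNormedModule)), Hex; lra|apply HM; lra]. }
unfold upper_Gamma; fold g.
rewrite (is_RInt_gen_unique g l Hgen); exact Hgen.
Qed.

(** Replacing the gamma variable by [t / 2] gives [/ 2 * (t / 2) ^ (- k - 1) = 2 ^ k * t ^ (- k -
    1)], whence the factor [/ 2 ^ k]. *)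
Lemma is_RInt_gen_exp_half_pow (k : nat) (x : R) : 0 < x ->
  is_RInt_gen (fun t => exp (- t / 2) * (/ t) ^ S k) (at_point x) (Rbar_locally p_infty)
    (/ 2 ^ k * upper_Gamma (- INR k) (x / 2)).
Proof.
intro hx.
assert (hk := pos_INR k).
assert (H := is_RInt_gen_upper_Gamma (- INR k) (x / 2) ltac:(lra) ltac:(lra)).
replace (x / 2) with (/ 2 * x) in H by field.
apply is_RInt_gen_comp_scal in H; [|lra].
apply (is_RInt_gen_scal _ (/ 2 ^ k)) in H.
replace (x / 2) with (/ 2 * x) by field.
revert H; apply is_RInt_gen_ext.
apply (Filter_prod _ _ _ (fun s => s = x) (fun t => x < t)); [reflexivity|exists x; auto|].
intros s T -> hT t ht; simpl in ht; rewrite Rmin_left in ht by lra.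
change (/ 2 ^ k * (/ 2 * (Rpower (/ 2 * t) (- INR k - 1) * exp (- (/ 2 * t)))) =
  exp (- t / 2) * (/ t) ^ S k).
replace (- INR k - 1) with (- INR (S k)) by (rewrite S_INR; ring).
rewrite Rpower_Ropp, Rpower_pow by lra.
rewrite Rpow_mult_distr, !pow_inv.
replace (- (/ 2 * t)) with (- t / 2) by field.
simpl; field; repeat split; try (apply pow_nonzero); lra.
Qed.

Theorem theorem35 (n : nat) (x : R) (hx : 0 < x) :
  whittaker_wi 0 (INR n + 1 / 2) x =
  sum_f_R0
    (fun k : nat =>
       INR (fact (n + k)) * / 2 ^ k / (INR (fact k) * INR (fact (n - k))) *
       upper_Gamma (- INR k) (x / 2))
    n.
Proof.
apply (is_RInt_gen_unique (V := R_CompleteNormedModule)).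
apply (is_RInt_gen_ext
  (fun t => sum_f_R0 (fun k => bessel_coef n k * (exp (- t / 2) * (/ t) ^ S k)) n)).
(* The integrands need only agree on intervals starting at [x > 0], where [tricomi_U] is known. *)
- apply (Filter_prod _ _ _ (fun s => s = x) (fun t => x < t)); [reflexivity|exists x; auto|].
  intros s T -> hT t ht; simpl in ht; rewrite Rmin_left in ht by lra.
  unfold whittaker_W.
  replace (1 / 2 + (INR n + 1 / 2) - 0) with (INR n + 1) by field.
  replace (1 + 2 * (INR n + 1 / 2)) with (2 * INR n + 2) by field.
  replace (INR n + 1 / 2 + 1 / 2) with (INR (n + 1)) by (rewrite plus_INR; simpl; field).
  rewrite tricomi_U_half_integer, Rpower_pow by lra.
  (* The power [t ^ (n + 1)] cancels the common factor of [bessel_U]; the division by [t] turns the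
     exponent [k] into [S k]. *)
  unfold bessel_U, Rdiv at 2; rewrite (Rmult_comm (exp (- t / 2) * _)), Rmult_assoc, Rmult_comm.
  rewrite scal_sum; apply sum_eq; intros k _.
  rewrite pow_add, <- tech_pow_Rmult, !pow_inv.
  field; repeat split; try (apply pow_nonzero); lra.
- rewrite (sum_eq _ (fun k => bessel_coef n k * (/ 2 ^ k * upper_Gamma (- INR k) (x / 2)))).
  + apply is_RInt_gen_sum_f_R0; [apply at_point_filter|apply Rbar_locally_filter|intro k].
    apply (is_RInt_gen_scal (V := R_NormedModule) _ (bessel_coef n k)), is_RInt_gen_exp_half_pow, hx.
  + intros k _; unfold bessel_coef, Rdiv; ring.
Qed.
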